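(* Let $n\ge 1$, $1\le m\le n$ and $0\le t\le m-1$ be integers and consider the flag-shaped minimum blocker $B_n(m,t)$ of all $n\times n$ $123$-avoiding permutation matrices. Then for every position $(i,j)$ with $n-t+1\le i\le n$ and $m+1\le j\le n$ (the $t\times(n-m)$ block of adjacent positions containing $(n,n)$), there is no $n\times n$ $123$-avoiding permutation matrix $P$ with a $1$ in position $(i,j)$ that intersects $B_n(m,t)$ exactly once (i.e. has exactly one $1$ in a position of $B_n(m,t)$).
   Context: A permutation matrix $P$ contains a $123$-pattern if $I_3$ is a submatrix of $P$; otherwise $P$ is $123$-avoiding. A set of positions is a blocker if every $n\times n$ $123$-avoiding permutation matrix has a $1$ in one of its positions, and it is minimum if removing any element makes it no longer a blocker. For integers $1\le m\le n$, $0\le t\le m-1$, the flag-shaped blocker $B_n(m,t)$ is the union of $\{(i,m): 1\le i\le n-t\}$ and $\{(i,j): 1\le i\le n-m+1,\ m-t\le j\le m-1\}$, positions written as (row, column); it is a minimum blocker. *)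

(* Defs.v *)
From mathcomp Require Import all_boot all_order all_algebra.

Set Implicit Arguments.
Unset Strict Implicit.
Unset Printing Implicit Defensive.

Import GRing.Theory.

Definition strictly_increasing (k n : nat) (f : 'I_k -> 'I_n) : Prop :=
  forall a b : 'I_k, (a < b)%N -> (f a < f b)%N.

(* Rows and columns of the submatrix are selected independently, each in
   increasing order. *)
Definition contains123 (n : nat) (P : 'M[int]_n) : Prop :=
  exists f g : 'I_3 -> 'I_n,
    [/\ strictly_increasing f, strictly_increasing g & mxsub f g P = 1%:M%R].

Definition avoiding123 (n : nat) (P : 'M[int]_n) : Prop :=
  is_perm_mx P /\ ~ contains123 P.

(* Positions are (row, column) pairs; the ordinals count from 0, while the
   mathematical positions count from 1, whence the shifts [p.1.+1], [p.2.+1]. *)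
Definition flag_blocker (n m t : nat) : {set 'I_n * 'I_n} :=
  [set p : 'I_n * 'I_n | (1 <= p.1.+1 <= n - t)%N && (p.2.+1 == m)]
  :|: [set p : 'I_n * 'I_n | (1 <= p.1.+1 <= n - m + 1)%N
             && (m - t <= p.2.+1 <= m - 1)%N].

Definition hits (n : nat) (P : 'M[int]_n) (B : {set 'I_n * 'I_n}) : nat :=
  #|[set p in B | P p.1 p.2 == 1%R]|.

(* Main.v *)
Require Import Defs.
From mathcomp Require Import all_boot all_order all_algebra.
From mathcomp Require Import fingroup perm zify.

(** Write [s] for the permutation of [P], so that column [c] meets row
    [s^-1 c].  Since [P] hits the blocker once, all but one of the [t + 1]
    columns m-t, ..., m have their 1 below row n-m+1.  Column [j] also has its
    1 below row n-m+1, so by counting some row [k <= n-m+1] has its 1 in a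
    column left of m-t.  The 1s in those [t] columns lie below row [k] and to
    the right of it, so to avoid a 123-pattern with [k] and (i,j) they must all
    lie below row [i]; but fewer than [t] rows remain there. *)

Lemma card_ord_interval (n a b : nat) :
  b <= n -> #|[set x : 'I_n | a <= x < b]| = b - a.
Proof.
move=> le_bn; rewrite -sum1dep_card.
rewrite -(big_mkord (fun x => a <= x < b) (fun=> 1)).
rewrite -[RHS]muln1 -sum_nat_const_nat (big_nat_widenl a 0) //.
by rewrite (big_nat_widen 0 b n) //=; apply: eq_bigl => x; lia.
Qed.

Lemma strictly_increasing_tnth3 (n : nat) (a b c : 'I_n) :
  a < b -> b < c -> strictly_increasing (tnth [tuple a; b; c]).
Proof.
move=> lt_ab lt_bc [[|[|[|//]]] ?] [[|[|[|//]]] ?] //= _;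
  by rewrite !(tnth_nth a) //= (ltn_trans lt_ab lt_bc).
Qed.

Lemma perm_mx_contains123 (n : nat) (s : {perm 'I_n}) (a b c : 'I_n) :
  a < b -> b < c -> s a < s b -> s b < s c ->
  contains123 (perm_mx s : 'M[int]_n).
Proof.
move=> lt_ab lt_bc lt_sab lt_sbc.
set f := tnth [tuple a; b; c]; exists f, (s \o f).
have f_incr : strictly_increasing f by apply: strictly_increasing_tnth3.
(* Written as a tuple, the columns increase for the same reason as the rows. *)
have sfE x : (s \o f) x = tnth [tuple s a; s b; s c] x.
  by rewrite /f /= !(tnth_nth a); case: x => [[|[|[|]]] ?].
split=> //.
  by move=> x y lt_xy; rewrite !sfE; apply: strictly_increasing_tnth3.
have f_inj : injective f.
  move=> x y eq_f; apply: val_inj; case: (ltngtP x y) => // lt_xy;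
  by have := f_incr _ _ lt_xy; rewrite eq_f ltnn.
by apply/matrixP=> x y; rewrite !mxE /= (inj_eq perm_inj) (inj_eq f_inj).
Qed.

Lemma perm_mx_eq1 (n : nat) (s : {perm 'I_n}) (i j : 'I_n) :
  ((perm_mx s : 'M[int]_n) i j == 1%R) = (s i == j).
Proof. by rewrite !mxE; case: (s i == j). Qed.

(** [c0] is the column of the only hit: a 1 in another flag column and in the first n-m+1 rows would
    be a second hit. For column m this rests on n-m+1 <= n-t. *)
Lemma flag_hit_column (n m t : nat) (s : {perm 'I_n}) :
  1 <= m -> t <= m - 1 ->
  hits (perm_mx s : 'M[int]_n) (flag_blocker n m t) = 1 ->
  exists2 c0 : 'I_n, m - t <= c0.+1 <= m &
    forall k : 'I_n, m - t <= (s k).+1 <= m -> s k != c0 -> n - m + 1 <= k.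
Proof.
move=> m_gt0 le_tm /eqP /cards1P [p hitsE].
have pB : p \in flag_blocker n m t.
  by have := set11 p; rewrite -hitsE inE => /andP [].
exists p.2 => [|k k_flag].
  by move: pB; rewrite !inE /= => /orP [] /andP [_]; lia.
apply: contraNT; rewrite -ltnNge => k_low.
suff : (k, s k) \in [set p] by rewrite inE => /eqP <-.
rewrite -hitsE inE perm_mx_eq1 eqxx andbT !inE /=.
by have := ltn_ord (s k); lia.
Qed.

(** Pigeonhole: otherwise the first n-m+1 rows have their 1s in [c0] or in the n-m columns of index
    at least m. Row [i], which is not among them, occupies one of the latter, so at most n-m columns
    are available. *)
Lemma low_row_left_column (n m l : nat) (s : {perm 'I_n}) (c0 i : 'I_n) :
  m <= n -> 1 <= m -> n - m + 1 <= i -> m <= s i ->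
  (forall k : 'I_n, l <= s k < m -> s k != c0 -> n - m + 1 <= k) ->
  exists2 k : 'I_n, k < n - m + 1 & s k < l.
Proof.
move=> le_mn m_gt0 i_high si_right flag_low.
apply/exists_inP; apply: contraT => /exists_inPn no_left.
set L := [set k : 'I_n | 0 <= k < n - m + 1].
set D := [set c : 'I_n | m <= c < n].
have : s @: L \subset c0 |: D :\ s i.
  apply/subsetP=> _ /imsetP [k kL ->]; rewrite !inE (inj_eq perm_inj).
  rewrite inE /= in kL.
  have [//|sk_c0 /=] := eqVneq (s k) c0.
  have sk_l := no_left k kL.
  apply/andP; split; first by apply: contraTneq kL => ->; lia.
  rewrite ltn_ord andbT leqNgt; apply/negP => lt_skm.
  by have := flag_low k _ sk_c0; lia.
move/subset_leq_card; rewrite card_imset; last exact: perm_inj.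
have := cardsD1 (s i) D.
rewrite cardsU1 !card_ord_interval ?inE //; last by lia.
by rewrite si_right ltn_ord; case: (~~ _); move: #|_ :\ _| => d; lia.
Qed.

Theorem theorem4p2 (n m t : nat)
    (hn : (1 <= n)%N) (hm : (1 <= m <= n)%N) (ht : (0 <= t <= m - 1)%N)
    (i j : 'I_n)
    (hi : (n - t + 1 <= i.+1 <= n)%N) (hj : (m + 1 <= j.+1 <= n)%N) :
  ~ exists P : 'M[int]_n,
      [/\ avoiding123 P, P i j = 1%R & hits P (flag_blocker n m t) = 1%N].
Proof.
case=> _ [[/is_perm_mxP [s ->] no123] /eqP]; rewrite perm_mx_eq1 => /eqP si.
case/flag_hit_column=> [||c0 c0_flag flag_low]; try lia.
(* Counting from 0, [m - t - 1] is the leftmost flag column. *)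
have [k k_low sk_left] : exists2 k : 'I_n, k < n - m + 1 & s k < m - t - 1.
  apply: (@low_row_left_column n m _ s c0 i); rewrite ?si; try lia.
  by move=> k sk_flag; apply: flag_low; lia.
set C := [set c : 'I_n | m - t - 1 <= c < m] :\ c0.
have : (s^-1)%g @: C \subset [set x : 'I_n | i.+1 <= x < n].
  apply/subsetP=> _ /imsetP [c + ->]; rewrite !inE ltn_ord andbT.
  set r := (s^-1)%g c; have sr : s r = c by rewrite permKV.
  case/andP=> c_c0 c_flag.
  have r_high : n - m + 1 <= r by apply: flag_low; rewrite sr //; lia.
  (* [r = i] is excluded because column [j] lies right of the flag; [r < i] makes rows [k], [r], [i]
     a 123-pattern. *)
  rewrite ltnNge leq_eqVlt; apply/negP => /orP [/eqP/val_inj r_i | lt_ri].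
    by move: c_flag; rewrite -sr r_i si; lia.
  by apply: no123; apply: (@perm_mx_contains123 n s k r i); rewrite ?sr ?si; lia.
move/subset_leq_card; rewrite card_imset; last exact: perm_inj.
(* [c0] is one of the t+1 flag columns, so [C] has t elements, against at most t-1 rows below
   [i]. *)
have := cardsD1 c0 [set c : 'I_n | m - t - 1 <= c < m].
rewrite -/C !card_ord_interval ?inE; try lia.
by move: #|C| => d; lia.
Qed.
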